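(* Let $N$ be a finite connected network with a distinguished edge $uv$, $u\neq v$, of resistance $L\in\mathbb Z_{\ge2}$. Let $0<a,b\le 1/3$, put $\tau=L-1+a+b$, and let $N^-$ be the network obtained from $N$ by shortening the distinguished edge to resistance $\tau$ (all other resistances unchanged). Let $m\in\{0,\ldots,L-1\}$, put $t=(m+a)/\tau$, and put $\nu(x)=(1-x)\mathbf e_u+x\mathbf e_v$. Then for every probability vector $\eta$ on $V(N)$, $$Q_{N^-}(\nu(t)-\eta)+\tau t(1-t)\le\max_{j\in\{m,m+1\}}\left\{Q_N(\nu(j/L)-\eta)+L\,\frac jL\left(1-\frac jL\right)\right\}.$$
   Context: A network is a finite connected loopless multigraph (parallel edges allowed) with arbitrary positive edge resistances. For a network $N$, $\mathcal L_N$ is its weighted Laplacian (weights are the conductances, i.e. reciprocal resistances), $\mathcal L_N^+$ is the Moore-Penrose pseudoinverse, and for a vector $\zeta\in\mathbb R^{V(N)}$ with coordinate sum zero, $Q_N(\zeta)=\zeta^{\mathsf T}\mathcal L_N^+\zeta$. $\mathbf e_x$ is the standard basis vector at vertex $x$. A probability vector is a vector in $\mathbb R^{V(N)}$ with nonnegative coordinates summing to one. *)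

(* Defs.v *)
From mathcomp Require Import all_boot all_order all_algebra.
From mathcomp Require Import reals.

Set Implicit Arguments.
Unset Strict Implicit.
Unset Printing Implicit Defensive.

Import Order.TTheory GRing.Theory Num.Theory.

Local Open Scope ring_scope.

Section MoorePenrose.
Variable R : realFieldType.

(** The four Penrose conditions, over a real field (so conjugate transpose is
    transpose). *)
Definition penrose (m n : nat) (A : 'M[R]_(m, n)) (X : 'M[R]_(n, m)) : bool :=
  [&& A *m X *m A == A, X *m A *m X == X,
      (A *m X)^T == A *m X & (X *m A)^T == X *m A].

Lemma rV_norm_eq0 (n : nat) (w : 'rV[R]_n) : w *m w^T = 0 -> w = 0.
Proof.
move=> /matrixP /(_ 0 0); rewrite !mxE => /eqP.
rewrite psumr_eq0 => [/allP w0|i _]; last by rewrite mxE -expr2 sqr_ge0.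
apply/rowP => i; have := w0 i (mem_index_enum i).
by rewrite !mxE /= mulf_eq0 orbb => /eqP.
Qed.

Lemma gram_unitmx (m n : nat) (B : 'M[R]_(m, n)) :
  row_free B -> B *m B^T \in unitmx.
Proof.
move=> freeB; rewrite -row_free_unit -kermx_eq0; apply/eqP/row_matrixP => i.
rewrite row0; set w := row i _.
have w0 : w *m (B *m B^T) = 0 by rewrite -row_mul mulmx_ker row0.
have wB0 : w *m B = 0.
  by apply: rV_norm_eq0; rewrite trmx_mul !mulmxA -(mulmxA w) w0 mul0mx.
by apply: (row_free_inj freeB); rewrite wB0 mul0mx.
Qed.

Lemma penrose_full_rank (m n r : nat) (C : 'M[R]_(m, r)) (B : 'M[R]_(r, n)) :
    row_free C^T -> row_free B ->
  penrose (C *m B)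
    (B^T *m invmx (B *m B^T) *m (invmx (C^T *m C) *m C^T)).
Proof.
move=> /gram_unitmx; rewrite trmxK => uC /gram_unitmx uB.
set G := invmx (B *m B^T); set H := invmx (C^T *m C).
have GT : G^T = G by rewrite /G trmx_inv trmx_mul trmxK.
have HT : H^T = H by rewrite /H trmx_inv trmx_mul trmxK.
have BG : B *m (B^T *m G) = 1%:M by rewrite mulmxA mulmxV.
have HC : H *m C^T *m C = 1%:M by rewrite -mulmxA mulVmx.
set X := _ *m _ *m _.
have AX : C *m B *m X = C *m (H *m C^T).
  by rewrite /X -(mulmxA C) (mulmxA B) BG mul1mx.
have XA : X *m (C *m B) = B^T *m G *m B.
  by rewrite /X -(mulmxA _ _ (C *m B)) (mulmxA _ C) HC mul1mx.
apply/and4P; split; apply/eqP.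
- by rewrite AX mulmxA -(mulmxA C) HC mulmx1.
- by rewrite XA /X mulmxA -(mulmxA _ B) BG mulmx1.
- by rewrite AX !trmx_mul trmxK HT mulmxA.
- by rewrite XA !trmx_mul trmxK GT mulmxA.
Qed.

Lemma penrose_exists (m n : nat) (A : 'M[R]_(m, n)) : exists X, penrose A X.
Proof.
rewrite -[A]mulmx_base; eexists; apply: penrose_full_rank.
- by rewrite /row_free mxrank_tr; apply: col_base_full.
- exact: row_base_free.
Qed.

Lemma penrose_unique (m n : nat) (A : 'M[R]_(m, n)) (X Y : 'M[R]_(n, m)) :
  penrose A X -> penrose A Y -> X = Y.
Proof.
move=> /and4P[/eqP aX /eqP xX /eqP sX /eqP tX].
move=> /and4P[/eqP aY /eqP xY /eqP sY /eqP tY].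
have AXY : A *m X = A *m Y.
  rewrite -sX -[in LHS]aY -(mulmxA _ A X) trmx_mul sX sY.
  by rewrite mulmxA aX.
have XYA : X *m A = Y *m A.
  rewrite -tX -[in LHS]aY -(mulmxA A) mulmxA trmx_mul tX tY.
  by rewrite -mulmxA (mulmxA A) aX.
by rewrite -xX XYA -mulmxA AXY mulmxA xY.
Qed.

Definition mp_pinv (m n : nat) (A : 'M[R]_(m, n)) : 'M[R]_(n, m) :=
  xchoose (penrose_exists A).

Lemma mp_pinvP (m n : nat) (A : 'M[R]_(m, n)) : penrose A (mp_pinv A).
Proof. exact: xchooseP. Qed.

End MoorePenrose.

Section Networks.
Variables (R : realType) (n : nat).

(** Edges form a type of their own, so parallel edges are allowed; [ends e] is
    the unordered set of end vertices of [e]. *)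
Record wgraph := WGraph {
  edge : finType;
  ends : edge -> {set 'I_n};
  resistance : edge -> R
}.

Definition adjacent (N : wgraph) : rel 'I_n :=
  fun x y => [exists e : edge N, ends e == [set x; y]].

(** Having exactly two ends makes every edge a non-loop. *)
Definition is_network (N : wgraph) : Prop :=
  [/\ forall e : edge N, #|ends e| = 2%N,
      forall e : edge N, 0 < resistance e &
      forall x y : 'I_n, connect (adjacent N) x y].

Definition set_resistance (N : wgraph) (e0 : edge N) (s : R) : wgraph :=
  WGraph (@ends N) (fun e => if e == e0 then s else resistance e).

Lemma set_resistance_network (N : wgraph) (e0 : edge N) (s : R) :
  0 < s -> is_network N -> is_network (set_resistance e0 s).
Proof. by move=> s0 [loopN posN conN]; split=> //= e; case: ifP. Qed.

Definition laplacian (N : wgraph) : 'M[R]_n :=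
  \matrix_(x, y)
    if x == y then \sum_(e : edge N | x \in ends e) (resistance e)^-1
    else - \sum_(e : edge N | ends e == [set x; y]) (resistance e)^-1.

Definition Q (N : wgraph) (zeta : 'cV[R]_n) : R :=
  (zeta^T *m mp_pinv (laplacian N) *m zeta) 0 0.

Definition basis_vec (x : 'I_n) : 'cV[R]_n := delta_mx x 0.

Definition prob_vec (eta : 'cV[R]_n) : Prop :=
  (forall x, 0 <= eta x 0) /\ \sum_x eta x 0 = 1.

Definition nu (u v : 'I_n) (x : R) : 'cV[R]_n :=
  (1 - x) *: basis_vec u + x *: basis_vec v.

End Networks.

(* Main.v *)
Require Import Defs.
From mathcomp Require Import all_boot all_order all_algebra.
From mathcomp Require Import reals.
From mathcomp Require Import ring lra.
Import Order.TTheory GRing.Theory Num.Theory.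
Local Open Scope ring_scope.

(** Let [d] be the unit dipole e_u - e_v and let phi, psi be potentials for
    the charges e_u - eta and [d].  Write P and r for the potential drops
    phi(u) - phi(v) and psi(u) - psi(v); thus r is the effective resistance
    between u and v.  Since nu(x) - eta = (e_u - eta) - x d, the energy
    Q_N(nu(x) - eta) is a quadratic polynomial in x determined by
    E = Q_N(e_u - eta), P and r ([Q_sub_dipole]).

    Shortening the edge adds kappa d d^T to the Laplacian, where
    kappa = 1/tau - 1/L, so the energy in the shortened network follows from
    the rank-one update formula of Sherman and Morrison ([Q_set_resistance])
    and depends on the same three numbers.  Working with the update, instead
    of deleting the edge, treats bridges like all other edges.

    What remains of the network are the bounds 0 <= P <= r <= L
    ([potential_drop_bounds], [effective_resistance_le]).  They follow from
    the maximum principle ([max_principle]): a potential with a single source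
    attains its maximum there.  The same principle shows that only constants
    have zero Laplacian, hence that every charge of total zero has a potential
    ([laplacian_pinvK]).

    In the variables rho = (L - r) / L^2 and z = P / L, so that rho >= 0 and
    0 <= z <= 1 - L rho, the right-hand sides become
    E + j (1 - 2 z) - j^2 rho.  With w = z + rho m, the term j = m is the
    larger one exactly when 2 w + rho >= 1, and then the claim is a quadratic
    inequality in w ([shortening_gap]).  The other case is the same inequality
    after exchanging the roles of u and v, which replaces
    (a, b, m, z) by (b, a, L - 1 - m, 1 - L rho - z). *)

(** * Laplacians of networks *)

Section Laplacian.
Context {R : realType} {n : nat}.
Implicit Type N : wgraph R n.

Definition conductance N (x y : 'I_n) : R :=
  \sum_(e : edge N | ends e == [set x; y]) (resistance e)^-1.

Lemma conductance_ge0 N x y : is_network N -> 0 <= conductance N x y.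
Proof.
by case=> _ posN _; apply: sumr_ge0 => e _; rewrite invr_ge0 ltW.
Qed.

Lemma inv_resistance_le_conductance N (e : edge N) x y :
  is_network N -> ends e = [set x; y] -> (resistance e)^-1 <= conductance N x y.
Proof.
case=> _ posN _ ends_e; rewrite /conductance (bigD1 e) /= ?ends_e //.
by rewrite lerDl; apply: sumr_ge0 => i _; rewrite invr_ge0 ltW.
Qed.

Lemma card2_set2E (A : {set 'I_n}) x y : #|A| = 2%N -> x != y ->
  (A == [set x; y]) = (x \in A) && (y \in A).
Proof.
move=> cardA neq_xy; apply/eqP/andP => [->|[xA yA]]; first by
  rewrite !inE !eqxx orbT.
apply/esym/eqP; rewrite eqEcard cardA cards2 neq_xy leqnn andbT.
by apply/subsetP => z; rewrite !inE => /orP[] /eqP->.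
Qed.

(** An edge at [x] has exactly one other end, so sorting the edges at [x] by
    that end counts each of them once. *)
Lemma sum_conductance N x : is_network N ->
  \sum_(y | y != x) conductance N x y
    = \sum_(e : edge N | x \in ends e) (resistance e)^-1.
Proof.
case=> loopN _ _; rewrite /conductance.
rewrite (exchange_big_dep (fun e => x \in ends e)) /=.
  apply: eq_bigr => e xe.
  have /cards2P[p [q [neq_pq ends_e]]] : #|ends e| == 2%N by rewrite loopN.
  have [y [neq_yx ends_xy]] : exists y, y != x /\ ends e = [set x; y].
    move: xe; rewrite ends_e !inE => /orP[] /eqP->.
      by exists q; rewrite eq_sym.
    by exists p; rewrite setUC.
  rewrite (big_pred1 y) // => z.
  apply/andP/eqP => /= [[neq_zx /eqP Ez]|->]; last by rewrite ends_xy.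
  have : z \in ends e by rewrite Ez !inE eqxx orbT.
  by rewrite ends_xy !inE (negPf neq_zx) => /eqP.
by move=> y e _ /eqP ends_e; rewrite ends_e !inE eqxx.
Qed.

Lemma laplacian_tr N : (laplacian N)^T = laplacian N.
Proof.
apply/matrixP => x y; rewrite !mxE eq_sym; case: eqP => [->//|_].
by rewrite setUC.
Qed.

Lemma laplacian_mulE N (f : 'cV[R]_n) x : is_network N ->
  (laplacian N *m f) x 0
    = \sum_(y | y != x) conductance N x y * (f x 0 - f y 0).
Proof.
move=> netN; rewrite !mxE (bigD1 x) //= !mxE eqxx -sum_conductance //.
rewrite mulr_suml -big_split /=; apply: eq_bigr => y neq_yx.
by rewrite !mxE eq_sym (negPf neq_yx) /conductance; ring.
Qed.

(** At a maximum [z] other than [u], the net outflow is a sum of nonnegative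
    terms that is at most 0, so every neighbour of [z] is a maximum as well;
    following a path to [u] shows that [u] is a maximum. *)
Lemma max_principle N (f : 'cV[R]_n) u : is_network N ->
  (forall x, x != u -> (laplacian N *m f) x 0 <= 0) ->
  forall x, f x 0 <= f u 0.
Proof.
move=> netN fsub; have [_ posN conN] := netN.
pose top z := [forall x, f x 0 <= f z 0].
have step z w : z != u -> top z -> adjacent N z w -> top w.
  move=> neq_zu /forallP topz /existsP[e /eqP ends_e].
  have [->//|neq_wz] := eqVneq w z; first exact/forallP.
  have term_ge0 y : 0 <= conductance N z y * (f z 0 - f y 0).
    by rewrite mulr_ge0 ?conductance_ge0 // subr_ge0.
  have sum0 : \sum_(y | y != z) conductance N z y * (f z 0 - f y 0) == 0.
    rewrite eq_le sumr_ge0 ?andbT // -laplacian_mulE //; exact: fsub.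
  have cond_gt0 : 0 < conductance N z w.
    apply: lt_le_trans (inv_resistance_le_conductance N e z w netN ends_e).
    by rewrite invr_gt0.
  move: sum0; rewrite psumr_eq0 // => /allP /(_ w (mem_index_enum w)).
  rewrite neq_wz mulf_eq0 gt_eqF //= subr_eq0 => /eqP eq_f.
  by apply/forallP => x; rewrite -eq_f.
have walk p z : top z -> path (adjacent N) z p -> last z p = u -> top u.
  elim: p z => [|w p IHp] z topz /= => [_ <-//|/andP[zw pathp] lastp].
  have [<-//|neq_zu] := eqVneq z u.
  exact: IHp (step z w neq_zu topz zw) pathp lastp.
have [z topz] : exists z, top z.
  case: (arg_maxP (fun x => f x 0) (isT : xpredT u)) => z _ maxz.
  by exists z; apply/forallP => x; apply: maxz.
have /connectP[p pathp lastp] := conN z u.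
by apply/forallP; apply: walk topz pathp (esym lastp).
Qed.

Lemma laplacian_ker N (f : 'cV[R]_n) : is_network N ->
  laplacian N *m f = 0 -> forall x y, f x 0 = f y 0.
Proof.
move=> netN f0 x y; apply/le_anti/andP.
by split; apply: max_principle netN _ _ => z _; rewrite f0 mxE.
Qed.

(** The defect [1 - A A^+] of the orthogonal projection onto the range of the
    Laplacian [A] has constant rows, because the kernel of [A] consists of the
    constant vectors; hence it kills every vector of coordinate sum zero. *)
Lemma laplacian_pinvK N (zeta : 'cV[R]_n) : is_network N ->
  \sum_x zeta x 0 = 0 ->
  laplacian N *m (mp_pinv (laplacian N) *m zeta) = zeta.
Proof.
move=> netN sum0; set A := laplacian N; set X := mp_pinv A.
have /and4P[/eqP AXA _ /eqP symAX _] : penrose A X by exact: mp_pinvP.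
pose D := 1%:M - A *m X.
have AD : A *m D = 0.
  have : (A *m D)^T = 0.
    rewrite trmx_mul /D raddfB /= trmx1 symAX laplacian_tr mulmxBl mul1mx.
    by rewrite AXA subrr.
  by move/(congr1 trmx); rewrite trmxK trmx0.
have symD i j : D i j = D j i.
  have DT : D^T = D by rewrite /D raddfB /= trmx1 symAX.
  by rewrite -[in LHS]DT mxE.
have rowD i j k : D i j = D i k.
  have colD : A *m col i D = 0 by rewrite colE mulmxA AD mul0mx.
  have := laplacian_ker N (col i D) netN colD j k.
  by rewrite [LHS]mxE [RHS]mxE !(symD i).
have : D *m zeta = 0.
  apply/matrixP => i j; rewrite ord1 [LHS]mxE [RHS]mxE.
  under eq_bigr => k _ do rewrite (rowD i k i).
  by rewrite -mulr_sumr sum0 mulr0.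
by rewrite /D mulmxBl mul1mx => /eqP; rewrite subr_eq0 mulmxA => /eqP.
Qed.

(** * Energies and potentials *)

Definition dotv (f g : 'cV[R]_n) : R := (f^T *m g) 0 0.

Lemma dotvBl f g h : dotv (f - g) h = dotv f h - dotv g h.
Proof. by rewrite /dotv raddfB /= mulmxBl !mxE. Qed.

Lemma dotvBr f g h : dotv h (f - g) = dotv h f - dotv h g.
Proof. by rewrite /dotv mulmxBr !mxE. Qed.

Lemma dotvZl c f g : dotv (c *: f) g = c * dotv f g.
Proof. by rewrite /dotv linearZ /= -scalemxAl !mxE. Qed.

Lemma dotvZr c f g : dotv f (c *: g) = c * dotv f g.
Proof. by rewrite /dotv -scalemxAr !mxE. Qed.

Lemma dotv_basis f x : dotv f (basis_vec R x) = f x 0.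
Proof. by rewrite /dotv /basis_vec -colE !mxE. Qed.

Lemma dotv_laplacianC N f g :
  dotv f (laplacian N *m g) = dotv g (laplacian N *m f).
Proof.
rewrite /dotv -[in LHS](trmxK (f^T *m _)) mxE.
by rewrite !trmx_mul trmxK laplacian_tr mulmxA.
Qed.

(** Any potential computes the energy of its charge, so energies can be compared
    through conveniently chosen potentials instead of pseudoinverses. *)
Lemma Q_potential N (phi : 'cV[R]_n) :
  Q N (laplacian N *m phi) = dotv phi (laplacian N *m phi).
Proof.
have /and4P[/eqP AXA _ _ _] := mp_pinvP (laplacian N).
by rewrite /Q /dotv trmx_mul laplacian_tr -[in RHS]AXA !mulmxA.
Qed.

Definition dipole (u v : 'I_n) : 'cV[R]_n := basis_vec R u - basis_vec R v.

Lemma dotv_dipole f u v : dotv f (dipole u v) = f u 0 - f v 0.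
Proof. by rewrite dotvBr !dotv_basis. Qed.

Lemma nu_subE u v x (eta : 'cV[R]_n) :
  nu u v x - eta = (basis_vec R u - eta) - x *: dipole u v.
Proof.
by apply/matrixP => i j; rewrite /nu /dipole !mxE; ring.
Qed.

Lemma sum_basis_vec (x : 'I_n) : \sum_y basis_vec R x y 0 = 1.
Proof.
rewrite (bigD1 x) //= big1 => [|y neq_yx]; first by rewrite mxE !eqxx addr0.
by rewrite mxE (negPf neq_yx).
Qed.

(** Only the four entries of the Laplacian indexed by [u] and [v] involve
    [e]. *)
Lemma laplacian_set_resistance N (e : edge N) (u v : 'I_n) s :
  u != v -> ends e = [set u; v] ->
  laplacian (set_resistance e s)
    = laplacian N
      + (s^-1 - (resistance e)^-1) *: (dipole u v *m (dipole u v)^T).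
Proof.
move=> neq_uv ends_e.
have sumE (P : pred (edge N)) :
    \sum_(i : edge N | P i) (if i == e then s else resistance i)^-1
      = \sum_(i : edge N | P i) (resistance i)^-1
        + (s^-1 - (resistance e)^-1) * (P e)%:R.
  case Pe: (P e); last first.
    rewrite mulr0 addr0; apply: eq_bigr => i Pi.
    by case: eqP Pi => [->|//]; rewrite Pe.
  rewrite (bigD1 e) //= [in RHS](bigD1 e) //= eqxx.
  under eq_bigr => i /andP[_ /negPf ne] do rewrite ne.
  by ring.
have dipoleE x y : (dipole u v *m (dipole u v)^T) x y
    = ((x == u)%:R - (x == v)%:R) * ((y == u)%:R - (y == v)%:R).
  by rewrite mxE big_ord1 !mxE !eqxx !andbT.
apply/matrixP => x y; rewrite [RHS]mxE [X in _ + X]mxE dipoleE !mxE /=.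
have [<-|neq_xy] := eqVneq x y.
  rewrite sumE ends_e !inE; congr (_ + _ * _).
  have [->|] := eqVneq x u; first by rewrite ?eqxx (negPf neq_uv) /=; ring.
  by case: (x == v) => _ /=; ring.
rewrite sumE opprD -mulrN ends_e; congr (_ + _ * _).
rewrite card2_set2E ?cards2 ?neq_uv // !inE.
have [xu|nxu] := eqVneq x u.
  have -> : (x == v) = false by rewrite xu; exact: negPf.
  have -> : (y == u) = false by rewrite -xu eq_sym; exact: negPf.
  by case: eqP => _ /=; ring.
have [xv|nxv] := eqVneq x v; last by rewrite /=; ring.
have -> : (y == v) = false by rewrite -xv eq_sym; exact: negPf.
by case: eqP => _ /=; ring.
Qed.

Lemma Q_sub_dipole N phi psi t u v : laplacian N *m psi = dipole u v ->
  Q N (laplacian N *m phi - t *: dipole u v)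
    = dotv phi (laplacian N *m phi) - 2 * t * (phi u 0 - phi v 0)
      + t ^+ 2 * (psi u 0 - psi v 0).
Proof.
move=> Apsi; rewrite -Apsi scalemxAr -mulmxBr Q_potential mulmxBr -scalemxAr.
rewrite dotvBl !dotvBr !dotvZl !dotvZr (dotv_laplacianC N psi phi) Apsi.
by rewrite !dotv_dipole; ring.
Qed.

(** Sherman-Morrison: in the modified network, [phi - c *: psi] is a potential
    for the charge of [phi], where [c] is chosen so that the contributions of
    the rank-one update along the dipole cancel. *)
Lemma Q_set_resistance N (e : edge N) (u v : 'I_n) s phi psi :
  u != v -> ends e = [set u; v] -> laplacian N *m psi = dipole u v ->
  let kappa := s^-1 - (resistance e)^-1 in
  1 + kappa * (psi u 0 - psi v 0) != 0 ->
  Q (set_resistance e s) (laplacian N *m phi)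
    = Q N (laplacian N *m phi)
      - kappa * (phi u 0 - phi v 0) ^+ 2 / (1 + kappa * (psi u 0 - psi v 0)).
Proof.
move=> neq_uv ends_e Apsi kappa nz; set r := psi u 0 - _ in nz *.
set p := phi u 0 - _.
pose c := kappa * p / (1 + kappa * r).
have rank1 f : (dipole u v *m (dipole u v)^T) *m f
    = (f u 0 - f v 0) *: dipole u v.
  rewrite -mulmxA; have -> : (dipole u v)^T *m f = (f u 0 - f v 0)%:M.
    apply/matrixP => i j; rewrite !ord1 [RHS]mxE eqxx mulr1n -dotv_dipole /dotv.
    by rewrite -[in LHS](trmxK (_ *m f)) mxE trmx_mul trmxK.
  by rewrite mul_mx_scalar.
have Nphi : laplacian (set_resistance e s) *m (phi - c *: psi)
    = laplacian N *m phi.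
  rewrite (laplacian_set_resistance _ _ u v) // mulmxDl mulmxBr -scalemxAr Apsi.
  rewrite -scalemxAl rank1 !scalerA.
  have -> : (phi - c *: psi) u 0 - (phi - c *: psi) v 0 = p - c * r.
    by rewrite !mxE /p /r; ring.
  rewrite -addrA -scaleNr -scalerDl -/kappa.
  have -> : - c + kappa * (p - c * r) = 0 by rewrite /c; field.
  by rewrite scale0r addr0.
rewrite -Nphi Q_potential Nphi Q_potential dotvBl dotvZl.
by rewrite (dotv_laplacianC N psi phi) Apsi dotv_dipole -/p /c; field.
Qed.

End Laplacian.

(** * Bounds on potential drops *)

Section Drops.
Context {R : realType} {n : nat}.
Implicit Type N : wgraph R n.

(** The potential [phi] has its only source at [u], whence the lower bound;
    [phi - psi] is a potential for the charge with source [v] instead of [u],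
    and comparing [u] with [v] there gives the upper bound. *)
Lemma potential_drop_bounds N (u v : 'I_n) (eta phi psi : 'cV[R]_n) :
  is_network N -> (forall x, 0 <= eta x 0) ->
  laplacian N *m phi = basis_vec R u - eta ->
  laplacian N *m psi = dipole u v ->
  0 <= phi u 0 - phi v 0 <= psi u 0 - psi v 0.
Proof.
move=> netN eta0 Aphi Apsi; apply/andP; split.
  rewrite subr_ge0; apply: max_principle netN _ _ => x neq_xu.
  by rewrite Aphi !mxE (negPf neq_xu) sub0r oppr_le0.
have Adiff : laplacian N *m (phi - psi) = basis_vec R v - eta.
  by rewrite mulmxBr Aphi Apsi; apply/matrixP => i j; rewrite !mxE; ring.
have := max_principle N (phi - psi) v netN; rewrite Adiff => /(_ _ u).
rewrite !mxE => le_uv.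
suff : phi u 0 - psi u 0 <= phi v 0 - psi v 0 by lra.
apply: le_uv => x neq_xv.
by rewrite !mxE (negPf neq_xv) sub0r oppr_le0.
Qed.

(** Every current leaving [u] in the unit flow from [u] to [v] is nonnegative,
    so the current through [e] alone is at most 1. *)
Lemma effective_resistance_le N (e : edge N) (u v : 'I_n) (psi : 'cV[R]_n) :
  is_network N -> u != v -> ends e = [set u; v] ->
  laplacian N *m psi = dipole u v ->
  psi u 0 - psi v 0 <= resistance e.
Proof.
move=> netN neq_uv ends_e Apsi; have [_ posN _] := netN.
have psi_max x : psi x 0 <= psi u 0.
  apply: max_principle netN _ x => x neq_xu.
  by rewrite Apsi !mxE (negPf neq_xu) sub0r oppr_le0 ler0n.
have : (laplacian N *m psi) u 0 = 1.
  by rewrite Apsi !mxE !eqxx (negPf neq_uv) subr0.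
rewrite laplacian_mulE // (bigD1 v) 1?eq_sym //= => flow1.
have : (resistance e)^-1 * (psi u 0 - psi v 0) <= 1.
  rewrite -flow1.
  apply: le_trans (_ : conductance N u v * (psi u 0 - psi v 0) <= _).
    by apply: ler_wpM2r; rewrite ?subr_ge0 ?inv_resistance_le_conductance.
  rewrite lerDl; apply: sumr_ge0 => y _.
  by rewrite mulr_ge0 ?conductance_ge0 ?subr_ge0.
by rewrite mulrC ler_pdivrMr // mul1r.
Qed.

End Drops.

(** * The inequality between energies *)

Section Bounds.
Variable R : realFieldType.

(** The expression increases with [w] on w >= 0.  At the smallest value
    w = (1 - rho) / 2 allowed by the last hypothesis it equals
    (1 - a - b) (1 - rho)^2 / 4 - a b rho, which is nonnegative for
    rho <= 1/3.  If rho > 1/3, then L = 2; here m = 0 would force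
    w <= 1 - 2 rho < (1 - rho) / 2, and m = 1 gives w >= rho, at which the
    inequality holds. *)
Lemma shortening_gap (L m : nat) (a b z rho : R) :
  0 < a <= 1 / 3 -> 0 < b <= 1 / 3 -> (2 <= L)%N -> (m < L)%N ->
  0 <= rho -> 0 <= z <= 1 - L%:R * rho ->
  let w := z + rho * m%:R in
  1 <= 2 * w + rho ->
  0 <= (1 - a - b) * w ^+ 2 + 2 * a * w + a ^+ 2 * rho
       - a * (1 - (1 - a - b) * rho).
Proof.
move=> /andP[a0 a1] /andP[b0 b1] L2 mL r0 /andP[z0 z1] w hw.
have ab : a * b <= 1 / 9 by nra.
have d0 : 1 / 3 <= 1 - a - b by lra.
have [rle|rgt] := lerP rho (1 / 3).
  set h := (1 - rho) / 2.
  have h0 : 0 <= h by rewrite /h; lra.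
  have hle : h <= w by rewrite /h; lra.
  have hw2 : h ^+ 2 <= w ^+ 2 by nra.
  have base : a * b * rho <= (1 - a - b) * h ^+ 2.
    have h1 : 1 / 3 <= h by rewrite /h; lra.
    have : 1 / 9 <= h ^+ 2 by nra.
    nra.
  have : (1 - a - b) * h ^+ 2 <= (1 - a - b) * w ^+ 2.
    by apply: ler_wpM2l => //; lra.
  have : a * h <= a * w by apply: ler_wpM2l => //; lra.
  rewrite {2}/h; nra.
have L_eq2 : L = 2%N.
  apply/eqP; rewrite eqn_leq L2 andbT leqNgt; apply/negP => L3.
  have : 3%:R <= L%:R :> R by rewrite ler_nat.
  nra.
subst L; case: m mL @w hw => [|[|//]] _ /= hw; first lra.
have wr : rho <= z + rho * 1 by lra.
move: (z + rho * 1) wr => w wr.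
have : (1 - a - b) * rho ^+ 2 <= (1 - a - b) * w ^+ 2.
  by apply: ler_wpM2l; nra.
have : a * rho <= a * w by apply: ler_wpM2l => //; lra.
have : a * b * rho <= (1 - a - b) * rho ^+ 2.
  have : a * b <= (1 - a - b) * rho by nra.
  nra.
nra.
Qed.

(** The comparison in terms of E, P and r alone.  After the substitution for
    rho and z, each of the two differences of sides is the expression of
    [shortening_gap], or its mirror image, divided by
    1 - (1 - a - b) rho > 0. *)
Lemma shortened_energy_le (L m : nat) (a b E P r : R) :
  0 < a <= 1 / 3 -> 0 < b <= 1 / 3 -> (2 <= L)%N -> (m < L)%N ->
  0 <= P <= r -> r <= L%:R ->
  let tau := L%:R - 1 + a + b in
  let t := (m%:R + a) / tau in
  let kappa := tau^-1 - L%:R^-1 in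
  let rhs (j : nat) := E - 2 * (j%:R / L%:R) * P + (j%:R / L%:R) ^+ 2 * r
                       + L%:R * (j%:R / L%:R) * (1 - j%:R / L%:R) in
  E - 2 * t * P + t ^+ 2 * r - kappa * (P - t * r) ^+ 2 / (1 + kappa * r)
    + tau * t * (1 - t) <= Num.max (rhs m) (rhs m.+1).
Proof.
move=> ha hb L2 mL /andP[P0 Pr] rL; cbv zeta.
set tau := L%:R - 1 + a + b; set t := _ / tau; set kappa := tau^-1 - _.
pose rhs (j : nat) := E - 2 * (j%:R / L%:R) * P + (j%:R / L%:R) ^+ 2 * r
                      + L%:R * (j%:R / L%:R) * (1 - j%:R / L%:R).
rewrite -[X in Num.max X _]/(rhs m) -[X in Num.max _ X]/(rhs m.+1).
have [/andP[a0 a1] /andP[b0 b1]] := (ha, hb).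
have l2 : 2 <= L%:R :> R by rewrite (ler_nat _ 2).
pose l : R := L%:R; pose rho := (l - r) / l ^+ 2; pose z := P / l.
pose dlt := 1 - a - b; pose M : R := m%:R.
have l0 : 0 < l by rewrite /l; lra.
have tau0 : 0 < tau by rewrite /tau; lra.
have rho0 : 0 <= rho by rewrite /rho divr_ge0 ?sqr_ge0 // subr_ge0.
have r_def : r = l - l ^+ 2 * rho by rewrite /rho; field; rewrite gt_eqF.
have P_def : P = z * l by rewrite /z; field; rewrite gt_eqF.
have z0 : 0 <= z by rewrite divr_ge0 // ltW.
have z1 : z <= 1 - l * rho.
  by rewrite -(ler_pM2r l0) -P_def; apply: le_trans Pr _; rewrite r_def; lra.
have den0 : 0 < 1 - dlt * rho by rewrite /dlt; nra.
have rhsE (j : nat) : rhs j = E + j%:R * (1 - 2 * z) - j%:R ^+ 2 * rho.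
  by rewrite /rhs r_def P_def -/l; field; rewrite gt_eqF.
have kr : 1 + kappa * r = l * (1 - dlt * rho) / tau.
  rewrite /kappa r_def -/l /dlt /tau -/l; field.
  by rewrite !gt_eqF.
have lhsE : E - 2 * t * P + t ^+ 2 * r
      - kappa * (P - t * r) ^+ 2 / (1 + kappa * r) + tau * t * (1 - t)
    = E + (M + a) - (dlt * z ^+ 2 + 2 * z * (M + a) + rho * (M + a) ^+ 2)
                    / (1 - dlt * rho).
  have l_def : l = tau + dlt by rewrite /tau /dlt -/l; lra.
  rewrite kr /kappa r_def P_def /t -/l -/M.
  move: l_def l0 tau0 den0 => -> l0 tau0 den0.
  by field; rewrite !gt_eqF.
rewrite lhsE le_max !rhsE -/M -natr1 -/M.
have [wbig|wsmall] := lerP 1 (2 * (z + rho * M) + rho); apply/orP.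
  left; rewrite -subr_ge0.
  have gap := shortening_gap L m a b z rho ha hb L2 mL rho0.
  rewrite z0 z1 -/M -/dlt in gap.
  have {}gap := gap isT wbig.
  rewrite (_ : _ - _ = (dlt * (z + rho * M) ^+ 2 + 2 * a * (z + rho * M)
     + a ^+ 2 * rho - a * (1 - dlt * rho)) / (1 - dlt * rho)).
    by rewrite divr_ge0 // ltW.
  by field; rewrite gt_eqF.
right; rewrite -subr_ge0.
(* The parameters of the same configuration seen from [v]. *)
pose z' := 1 - l * rho - z; pose M' := l - 1 - M.
have M'E : (L - m.+1)%:R = M' by rewrite natrB // -natr1 /M' -/l -/M; lra.
have gap := shortening_gap L (L - m.+1) b a z' rho hb ha L2.
rewrite M'E ltn_subrL (ltn_trans _ L2) //= in gap.
have {}gap := gap isT rho0.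
have wE : z' + rho * M' = 1 - rho - (z + rho * M) by rewrite /z' /M'; ring.
have z'1 : 0 <= z' <= 1 - L%:R * rho by rewrite /z' -/l; lra.
have {}gap : 0 <= dlt * (z' + rho * M') ^+ 2 + 2 * b * (z' + rho * M')
    + b ^+ 2 * rho - b * (1 - dlt * rho).
  have -> : dlt = 1 - b - a by rewrite /dlt; ring.
  by apply: gap => //; rewrite wE; lra.
rewrite (_ : _ - _ = (dlt * (z' + rho * M') ^+ 2 + 2 * b * (z' + rho * M')
   + b ^+ 2 * rho - b * (1 - dlt * rho)) / (1 - dlt * rho)).
  by rewrite divr_ge0 // ltW.
rewrite wE /dlt; field; move: den0; rewrite /dlt => den0.
by rewrite gt_eqF.
Qed.

End Bounds.

(** * Shortening an edge *)

Theorem lemma5p1 (R : realType) (n : nat) (N : wgraph R n)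
    (u v : 'I_n) (e : edge N) (L m : nat) (a b : R) (eta : 'cV[R]_n)
    (networkN : is_network N)
    (neq_uv : u != v)
    (ends_e : ends e = [set u; v])
    (L_ge2 : (2 <= L)%N)
    (res_e : resistance e = L%:R)
    (a_bounds : 0 < a <= 1 / 3)
    (b_bounds : 0 < b <= 1 / 3)
    (m_ltL : (m < L)%N)
    (prob_eta : prob_vec eta) :
  let tau := L%:R - 1 + a + b in
  let Nminus := set_resistance e tau in
  let t := (m%:R + a) / tau in
  let rhs (j : nat) :=
    Q N (nu u v (j%:R / L%:R) - eta)
      + L%:R * (j%:R / L%:R) * (1 - j%:R / L%:R) in
  Q Nminus (nu u v t - eta) + tau * t * (1 - t)
    <= Num.max (rhs m) (rhs m.+1).
Proof.
cbv zeta; set tau := L%:R - 1 + a + b; set t := _ / tau.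
set Nminus := set_resistance e tau.
pose A := laplacian N.
have [phi Aphi] : exists phi, A *m phi = basis_vec R u - eta.
  eexists; apply: laplacian_pinvK => //.
  under eq_bigr => x _ do rewrite mxE [X in _ + X]mxE.
  by rewrite sumrB sum_basis_vec; case: prob_eta => _ ->; rewrite subrr.
have [psi Apsi] : exists psi, A *m psi = dipole u v.
  eexists; apply: laplacian_pinvK => //.
  under eq_bigr => x _ do rewrite mxE [X in _ + X]mxE.
  by rewrite sumrB !sum_basis_vec subrr.
set P := phi u 0 - phi v 0; set r := psi u 0 - psi v 0.
have P_bounds : 0 <= P <= r.
  by apply: potential_drop_bounds Aphi Apsi; case: prob_eta.
have r_le : r <= L%:R by rewrite -res_e; apply: effective_resistance_le Apsi.
have L_ge2R : 2 <= L%:R :> R by rewrite (ler_nat _ 2).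
have [tau_gt0 tau_leL] : 0 < tau /\ tau <= L%:R.
  by clear -a_bounds b_bounds L_ge2R; rewrite /tau; split; lra.
pose kappa := tau^-1 - L%:R^-1.
have kappa_ge0 : 0 <= kappa.
  by rewrite subr_ge0 lef_pV2 ?posrE // ltr0n (ltn_trans _ L_ge2).
have QN s : Q N (nu u v s - eta)
    = dotv phi (A *m phi) - 2 * s * P + s ^+ 2 * r.
  by rewrite nu_subE -Aphi (Q_sub_dipole _ _ psi).
have QNminus : Q Nminus (nu u v t - eta)
    = dotv phi (A *m phi) - 2 * t * P + t ^+ 2 * r
      - kappa * (P - t * r) ^+ 2 / (1 + kappa * r).
  rewrite -QN nu_subE -Aphi -Apsi scalemxAr -mulmxBr.
  rewrite (Q_set_resistance N e u v tau _ psi) // res_e -/kappa -/r.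
    congr (_ - _ * _ ^+ 2 / _); rewrite !mxE /P /r; ring.
  rewrite gt_eqF // ltr_wpDr // mulr_ge0 //.
  by case/andP: P_bounds; apply: le_trans.
rewrite !QN QNminus.
exact: shortened_energy_le.
Qed.
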